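(* For any complete graph $K_n$, all complex roots of the Ehrhart polynomial $H_{K_n}$ of its symmetric edge polytope $P_{K_n}$ lie on the line $R=\{z\in\mathbb{C}:\operatorname{Re}(z)=-\tfrac12\}$.
   Context: For a finite simple undirected graph $G=(V,E)$, let $\mathbb{Z}^{|V|}$ be the lattice with basis $(e_v)_{v\in V}$. The symmetric edge polytope $P_G\subset\mathbb{R}^{|V|}$ is the convex hull of all vectors $e_{v_1}-e_{v_2}$ with $\{v_1,v_2\}\in E$ (both orders, so each edge contributes $\pm(e_{v_1}-e_{v_2})$). If $G$ has no edges, $P_G$ is taken to be $\{0\}$. The Ehrhart polynomial $H_G$ is the polynomial with $H_G(s)=|sP_G\cap\mathbb{Z}^{|V|}|$ for all integers $s\ge 0$. *)

(* Defs.v *)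
From HB Require Import structures.
From mathcomp Require Import all_boot all_order all_algebra.
From mathcomp Require Import classical_sets cardinality reals.
From mathcomp Require Import complex.

Set Implicit Arguments.
Unset Strict Implicit.
Unset Printing Implicit Defensive.

Import Order.TTheory GRing.Theory Num.Theory.

Local Open Scope classical_set_scope.
Local Open Scope ring_scope.

Record sgraph (V : finType) := SGraph {
  adj : rel V;
  adj_sym : symmetric adj;
  adj_irrefl : irreflexive adj
}.

Lemma neq_op_sym (V : finType) : symmetric (fun u v : V => u != v).
Proof. by move=> u v; rewrite eq_sym. Qed.

Lemma neq_op_irrefl (V : finType) : irreflexive (fun u v : V => u != v).
Proof. by move=> v; rewrite eqxx. Qed.

Definition complete_graph (n : nat) : sgraph 'I_n :=
  SGraph (@neq_op_sym 'I_n) (@neq_op_irrefl 'I_n).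

Definition convex_hull (R : realType) (E : lmodType R) (A : set E) : set E :=
  [set x | exists (k : nat) (w : 'I_k -> R) (a : 'I_k -> E),
     [/\ forall i, 0 <= w i, \sum_i w i = 1, forall i, A (a i) &
         x = \sum_i w i *: a i]].


(* R^o rather than R makes the function space an lmodType R. *)
Definition basis_vec (R : realType) (V : finType) (v : V) : {ffun V -> R^o} :=
  [ffun u => (u == v)%:R].

Definition edge_vectors (R : realType) (V : finType) (G : sgraph V) :
    set {ffun V -> R^o} :=
  [set x | exists u v, adj G u v /\ x = basis_vec R u - basis_vec R v].
Arguments edge_vectors R {V} G.

(* The convex hull of the empty set is empty, so the edgeless case has to be
   treated apart. *)
Definition symmetric_edge_polytope (R : realType) (V : finType)
    (G : sgraph V) : set {ffun V -> R^o} :=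
  if [exists u, exists v, adj G u v] then convex_hull (edge_vectors R G)
  else [set 0].
Arguments symmetric_edge_polytope R {V} G.

Definition integer_lattice (R : realType) (V : finType) :
    set {ffun V -> R^o} :=
  [set x | forall v, (x v : R) \is a Num.int].
Arguments integer_lattice : clear implicits.

Definition dilate (R : realType) (E : lmodType R) (s : R) (P : set E) : set E :=
  [set s *: x | x in P].

Definition is_ehrhart (R : realType) (V : finType) (P : set {ffun V -> R^o})
    (H : {poly R}) : Prop :=
  forall s : nat, exists N : nat,
    (dilate s%:R P `&` integer_lattice R V #= `I_N)%card /\ H.[s%:R] = N%:R.

Lemma is_ehrhart_uniq (R : realType) (V : finType) (P : set {ffun V -> R^o})
    (H1 H2 : {poly R}) : is_ehrhart P H1 -> is_ehrhart P H2 -> H1 = H2.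
Proof.
move=> eH1 eH2; apply/eqP; rewrite -subr_eq0; apply/eqP.
apply: (@roots_geq_poly_eq0 _ _ [seq s%:R | s <- iota 0 (size (H1 - H2))]).
- apply/allP => _ /mapP[s _ ->]; rewrite rootE hornerD hornerN subr_eq0.
  have [N1 [c1 ->]] := eH1 s; have [N2 [c2 ->]] := eH2 s.
  apply/eqP; congr _%:R.
  by apply/card_eq_II; apply: card_eq_trans c2; rewrite card_eq_sym.
- by rewrite map_inj_uniq ?iota_uniq // => a b /eqP; rewrite eqr_nat => /eqP.
- by rewrite size_map size_iota.
Qed.

(* The default 0 is returned if no polynomial satisfies [is_ehrhart P]. *)
Definition ehrhart_poly (R : realType) (V : finType)
    (P : set {ffun V -> R^o}) : {poly R} :=
  xget 0 [set H | is_ehrhart P H].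

(* Main.v *)
Require Import Defs.
From HB Require Import structures.
From mathcomp Require Import all_boot all_order all_algebra.
From mathcomp Require Import classical_sets cardinality reals.
From mathcomp Require Import complex.
From mathcomp Require Import finmap zify ring lra.

(* A vector x lies in s P_(K_n) iff its coordinates sum to 0 and its l1-norm is
   at most 2s.  Such an integral x is determined by the vector y of its last
   d = n - 1 coordinates, which ranges over the y in Z^d whose positive entries
   and whose negative entries both have absolute sum at most s.  Splitting off
   one coordinate at a time, the number of such y is
     sum_i C(d,i) C(s,i) C(s+d-i,d-i) = sum_k C(d,k) C(d+k,k) C(s,k).
   This count H_d(s) satisfies the three-term recurrence of Bateman's
   polynomials,
     (d+2)^2 H_(d+2) = (2d+3) (2s+1) H_(d+1) + (d+1)^2 H_d,
   and so does the Ehrhart polynomial.  With u = 2z+1, the recurrence gives by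
   induction that Re u * Re (H_(d+1)(z) * conj (H_d(z))) > 0 whenever
   Re u <> 0, hence H_d(z) <> 0 off the line Re z = -1/2. *)

Set Implicit Arguments.
Unset Strict Implicit.
Unset Printing Implicit Defensive.

Import Order.TTheory GRing.Theory Num.Theory.

Local Open Scope classical_set_scope.
Local Open Scope ring_scope.

(** * Three-term recurrence for the counting function *)

Lemma mul_binS_row n m : (n.+1 * 'C(n, m) + m * 'C(n.+1, m) = n.+1 * 'C(n.+1, m))%N.
Proof.
have := mul_bin_down n.+1 m; rewrite /= => ->.
have [le_mn|lt_nm] := leqP m n.+1; last by rewrite bin_small ?muln0.
by rewrite -mulnDl subnK.
Qed.

(** Coefficient of x^k in the Legendre polynomial P_d(1 + 2x). *)
Definition legendre_coef (d k : nat) : nat := 'C(d, k) * 'C(d + k, k).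

(** Consecutive coefficients in k have ratio (d-k)(d+k+1)/(k+1)^2, and (d-k)(d+k+1) = d(d+1) -
    k(k+1); the negative term is moved to the left to stay in [nat]. *)
Lemma legendre_coefSk d k :
  (k.+1 ^ 2 * legendre_coef d k.+1 + k * k.+1 * legendre_coef d k
     = d * d.+1 * legendre_coef d k)%N.
Proof.
have [lt_dk|le_kd] := ltnP d k.
  by rewrite /legendre_coef (bin_small lt_dk) (@bin_small d k.+1) ?leqW // !muln0.
have e1 := mul_bin_left d k; have e2 := mul_bin_diag (d + k).+1 k.
rewrite /legendre_coef addnS /= in e2 *.
have -> : (k.+1 ^ 2 * ('C(d, k.+1) * 'C((d + k).+1, k.+1))
   = (k.+1 * 'C(d, k.+1)) * (k.+1 * 'C((d + k).+1, k.+1)))%N by lia.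
rewrite e1 -e2; move: 'C(d, k) 'C(d + k, k) => x y.
by rewrite -(subnKC le_kd); move: (d - k)%N => j; rewrite addKn; lia.
Qed.

(** The ratio in d is (d+1+k)/(d+1-k), again cleared of subtraction. *)
Lemma legendre_coefSd d k :
  (d.+1 * legendre_coef d.+1 k
     = (d.+1 + k) * legendre_coef d k + k * legendre_coef d.+1 k)%N.
Proof.
have e1 := mul_binS_row d k; have e2 := mul_binS_row (d + k) k.
rewrite /legendre_coef addSn.
move: 'C(d, k) 'C(d.+1, k) 'C(d + k, k) 'C((d + k).+1, k) e1 e2 => x x' y y' e1 e2.
(* Both products contain (d+1) x y', which is eliminated between them. *)
have e3 := congr1 (muln y') e1; have e4 := congr1 (muln x) e2.
lia.
Qed.

Lemma legendre_coef0 d : legendre_coef d 0 = 1%N.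
Proof. by rewrite /legendre_coef !bin0. Qed.

(** The recurrence of [crystal_ball] read off at C(s,k). At k = 0 the term with [k.-1] is harmless,
    its factor k being 0. *)
Lemma legendre_coef_rec d k :
  (d.+2 ^ 2 * legendre_coef d.+2 k
     = d.*2.+3 * (k.*2.+1 * legendre_coef d.+1 k
                  + 2 * k * legendre_coef d.+1 k.-1)
       + d.+1 ^ 2 * legendre_coef d k)%N.
Proof.
case: k => [|k] /=; first by rewrite !legendre_coef0; lia.
have e1 := legendre_coefSk d.+2 k; have b1 := legendre_coefSk d.+1 k.
have a1 := legendre_coefSk d k; have f := legendre_coefSd d k.
have g := legendre_coefSd d.+1 k.
move: (legendre_coef _ _) (legendre_coef _ _) (legendre_coef _ _)
  (legendre_coef _ _) (legendre_coef _ _) (legendre_coef _ _)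
  e1 b1 a1 f g => e' e b' b a' a e1 b1 a1 f g.
(* Once multiplied by (k+1)^2, each term is a multiple of b. *)
apply/eqP; rewrite -(@eqn_pmul2l (k.+1 ^ 2)) //; apply/eqP.
have he := congr1 (muln (d.+2 ^ 2)) e1.
have hb := congr1 (muln (d.*2.+3 * k.*2.+3)) b1.
have ha := congr1 (muln (d.+1 ^ 2)) a1.
have hf1 := congr1 (muln (d.+1 ^ 2 * d)) f.
have hf2 := congr1 (muln (d.+1 ^ 2 * k)) f.
have hg := congr1 (muln (d.+2 ^ 2 * (d.+3 + k))) g.
lia.
Qed.

(** Crystal ball sequence of the root lattice A_d: the number of sums of at most s roots, expanded
    in the basis C(s,k). *)
Definition crystal_ball (d s : nat) : nat :=
  \sum_(k < s.+1) legendre_coef d k * 'C(s, k).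

Lemma crystal_ball0 s : crystal_ball 0 s = 1%N.
Proof.
rewrite /crystal_ball big_ord_recl big1 => [|i _]; first by rewrite bin0 legendre_coef0.
by rewrite /legendre_coef /= bin0n /bump mul0n.
Qed.

Lemma crystal_ball1 s : crystal_ball 1 s = s.*2.+1.
Proof.
rewrite /crystal_ball big_ord_recl bin0 legendre_coef0.
case: s => [|s]; first by rewrite big_ord0.
rewrite big_ord_recl /= big1 => [|i _].
  rewrite /legendre_coef /bump /= !bin1; lia.
by rewrite /legendre_coef /= /bump /= bin_small.
Qed.

Lemma crystal_ball_rec d s :
  (d.+2 ^ 2 * crystal_ball d.+2 s
     = d.*2.+3 * s.*2.+1 * crystal_ball d.+1 s + d.+1 ^ 2 * crystal_ball d s)%N.
Proof.
have shift : (\sum_(k < s.+1) 2 * k * legendre_coef d.+1 k.-1 * 'C(s, k)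
    = \sum_(k < s.+1) 2 * k.+1 * legendre_coef d.+1 k * 'C(s, k.+1))%N.
  rewrite big_ord_recl muln0 !mul0n add0n [RHS]big_ord_recr /=.
  by rewrite (@bin_small s s.+1) // muln0 addn0.
(* Multiplication by 2s+1 in the binomial basis, from (s-k) C(s,k) = (k+1) C(s,k+1). *)
have mulC k : (k <= s)%N ->
    (s.*2.+1 * 'C(s, k) = k.*2.+1 * 'C(s, k) + 2 * k.+1 * 'C(s, k.+1))%N.
  move=> le_ks; have := mul_bin_left s k.
  move: 'C(s, k) 'C(s, k.+1) => x y; rewrite -{2}(subnK le_ks).
  by move: (s - k)%N => j; lia.
rewrite /crystal_ball -mulnA !big_distrr /=.
transitivity (\sum_(k < s.+1)
    (d.*2.+3 * (k.*2.+1 * legendre_coef d.+1 k * 'C(s, k))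
     + d.*2.+3 * (2 * k * legendre_coef d.+1 k.-1 * 'C(s, k))
     + d.+1 ^ 2 * (legendre_coef d k * 'C(s, k))))%N.
  by apply: eq_bigr => k _; rewrite mulnA legendre_coef_rec; lia.
rewrite big_split /=; congr addn; rewrite big_split /= -!big_distrr -mulnDr /=.
rewrite shift -big_split /=; congr muln; rewrite big_distrr.
apply: eq_bigr => k _ /=; rewrite mulnCA mulC; last by rewrite -ltnS.
by lia.
Qed.

(** * Closed form of the count, by number of positive entries *)

(** With i positive entries: C(d,i) choices of their places, C(p,i) positive i-tuples of sum at most
    p, and C(q+d-i,d-i) tuples of nonpositive entries of absolute sum at most q. *)
Definition quadrant_sum (d p q : nat) : nat :=
  \sum_(i < d.+1) 'C(d, i) * 'C(p, i) * 'C(q + (d - i), d - i).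

Lemma sum_binr d n : (\sum_(i < n.+1) 'C(i + d, d) = 'C(n + d.+1, d.+1))%N.
Proof.
elim: n => [|n IHn]; first by rewrite big_ord1 !add0n !binn.
by rewrite big_ord_recr /= IHn !addSn binS -addnS.
Qed.

Lemma sum_bin_lt p i : (\sum_(t < p) 'C(t, i) = 'C(p, i.+1))%N.
Proof.
by elim: p => [|p IHp]; rewrite ?big_ord0 ?bin0n // big_ord_recr /= IHp binS.
Qed.

Lemma quadrant_sum0 p q : quadrant_sum 0 p q = 1%N.
Proof. by rewrite /quadrant_sum big_ord1 subn0 !bin0. Qed.

(** The first entry is -(q-t) in the first sum and p-t in the second, t being the budget left. Both
    sums over t are hockey-stick identities, and Pascal's rule joins the results. *)
Lemma quadrant_sumS d p q :
  (quadrant_sum d.+1 p q = \sum_(t < q.+1) quadrant_sum d p t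
                           + \sum_(t < p) quadrant_sum d t q)%N.
Proof.
rewrite /quadrant_sum exchange_big [X in (_ + X)%N]exchange_big /=.
have -> : (\sum_(i < d.+1) \sum_(t < q.+1)
      'C(d, i) * 'C(p, i) * 'C(t + (d - i), d - i)
    = \sum_(i < d.+2) 'C(d, i) * 'C(p, i) * 'C(q + (d.+1 - i), d.+1 - i))%N.
  rewrite [RHS]big_ord_recr /= (@bin_small d d.+1) // !mul0n addn0.
  apply: eq_bigr => i _; rewrite -big_distrr /= sum_binr subSn //.
  by rewrite -ltnS.
rewrite [LHS]big_ord_recl [X in _ = (X + _)%N]big_ord_recl /= -addnA; congr addn.
  by rewrite !bin0.
rewrite -big_split; apply: eq_bigr => i _ /=.
rewrite /bump /= !add1n subSS binS !mulnDl; congr addn.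
rewrite -sum_bin_lt big_distrr big_distrl /=.
by apply: eq_bigr => t _.
Qed.

(** Both sides equal (s+d-i)! / (i! (s-i)! (d-i)!), or vanish if s < i. *)
Lemma bin_mul_bin_sub s d i : (i <= d)%N ->
  ('C(s, i) * 'C(s + (d - i), d - i) = 'C(d, i) * 'C(s + (d - i), d))%N.
Proof.
move=> le_id; have [lt_si|le_is] := ltnP s i.
  by rewrite (bin_small lt_si) (@bin_small (s + (d - i))%N d) ?muln0 //; lia.
have h1 := bin_fact le_is; have h2 := bin_fact le_id.
have h3 : (d - i <= s + (d - i))%N by lia.
have h4 : (d <= s + (d - i))%N by lia.
move: (bin_fact h3) (bin_fact h4) (fact_gt0 i) (fact_gt0 (s - i))
  (fact_gt0 (d - i)) (fact_gt0 d).
rewrite addnK (_ : s + (d - i) - d = s - i)%N; last by lia.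
rewrite -h1 -h2 => h5 h6 p1 p2 p3 p4; apply/eqP.
rewrite -(@eqn_pmul2r (i`! * (s - i)`! * (d - i)`!)) ?muln_gt0 ?p1 ?p2 //.
apply/eqP; lia.
Qed.

(** Both sides equal d! / (i! (d-k)! (k-i)!), or vanish if k < i. *)
Lemma bin_mul_bin_subC d i k : (i <= d)%N -> (k <= d)%N ->
  ('C(d, i) * 'C(d - i, d - k) = 'C(d, k) * 'C(k, i))%N.
Proof.
move=> le_id le_kd; have [lt_ki|le_ik] := ltnP k i.
  by rewrite (bin_small lt_ki) (@bin_small (d - i)) ?muln0 //; lia.
have h1 := bin_fact le_id; have h2 := bin_fact le_kd; have h3 := bin_fact le_ik.
have h4 : (d - k <= d - i)%N by lia.
have := bin_fact h4; rewrite (_ : d - i - (d - k) = k - i)%N; last by lia.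
move=> h5; have p1 := fact_gt0 i; have p2 := fact_gt0 (d - k).
have p3 := fact_gt0 (k - i).
apply/eqP; rewrite -(@eqn_pmul2r (i`! * (d - k)`! * (k - i)`!)) ?muln_gt0 ?p1 ?p2 //.
apply/eqP; transitivity d`!; first by rewrite -h1 -h5; lia.
by rewrite -h2 -h3; lia.
Qed.

Lemma sum_ord_trim (F : nat -> nat) m n :
  (m <= n)%N -> (forall k, (m <= k)%N -> F k = 0%N) ->
  (\sum_(k < n) F k = \sum_(k < m) F k)%N.
Proof.
move=> /subnKC <- F0; rewrite big_split_ord /= [X in (_ + X)%N]big1 ?addn0 //.
by move=> i _; rewrite F0 ?leq_addr.
Qed.

(** Vandermonde is used twice: it expands C(s+d-i,d) over k, and after exchanging the sums it
    collapses the sum over i of C(d,i) C(k,i) to C(d+k,k). *)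
Lemma quadrant_sum_diag d s : quadrant_sum d s s = crystal_ball d s.
Proof.
(* The terms vanish beyond both s and d, so the sum may stop at either. *)
transitivity (\sum_(k < d.+1) legendre_coef d k * 'C(s, k))%N; last first.
  have [le_sd|lt_ds] := leqP s d.
    apply: (@sum_ord_trim (fun k => legendre_coef d k * 'C(s, k))%N) => // k lt_sk.
    by rewrite (bin_small lt_sk) muln0.
  apply/esym.
  apply: (@sum_ord_trim (fun k => legendre_coef d k * 'C(s, k))%N) => [|k lt_dk].
    exact: ltnW.
  by rewrite /legendre_coef (bin_small lt_dk).
rewrite /quadrant_sum.
under eq_bigr => i _ do
  rewrite -mulnA bin_mul_bin_sub -1?ltnS // -binomial.Vandermonde !big_distrr.
rewrite exchange_big; apply: eq_bigr => k _ /=.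
rewrite /legendre_coef -[X in 'C(d + k, X)](addKn d) bin_sub ?leq_addr // addnC.
rewrite -binomial.Vandermonde big_distrr big_distrl; apply: eq_bigr => i _ /=.
have le_id : (i <= d)%N by rewrite -ltnS.
have le_kd : (k <= d)%N by rewrite -ltnS.
rewrite bin_sub //; have := bin_mul_bin_subC le_id le_kd.
by move=> /(congr1 (muln ('C(d, i) * 'C(s, k)))); lia.
Qed.

(** * Enumeration of the integer vectors *)

Definition pos_part (t : int) : nat := if t is Posz m then m else 0%N.
Definition neg_part (t : int) : nat := if t is Negz m then m.+1 else 0%N.

(** [p] and [q] are the budgets left for positive and negative entries. A zero head belongs to the
    first branch only, so nothing is listed twice. *)
Fixpoint quadrant_vectors (d p q : nat) : seq (seq int) :=
  if d is d'.+1 then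
    [seq - k%:Z :: y | k <- iota 0 q.+1, y <- quadrant_vectors d' p (q - k)]
    ++ [seq k.+1%:Z :: y | k <- iota 0 p, y <- quadrant_vectors d' (p - k.+1) q]
  else [:: [::]].

Lemma quadrant_vectorsS d p q : quadrant_vectors d.+1 p q =
  [seq - k%:Z :: y | k <- iota 0 q.+1, y <- quadrant_vectors d p (q - k)]
  ++ [seq k.+1%:Z :: y | k <- iota 0 p, y <- quadrant_vectors d (p - k.+1) q].
Proof. by []. Qed.

Lemma mem_quadrant_vectors d p q y :
  (y \in quadrant_vectors d p q) =
  [&& size y == d, (\sum_(t <- y) pos_part t <= p)%N
    & (\sum_(t <- y) neg_part t <= q)%N].
Proof.
elim: d p q y => [|d IHd] p q [|t y].
- by rewrite !big_nil.
- by [].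
- rewrite quadrant_vectorsS mem_cat; apply/negP.
  by move=> /orP[] /allpairsPdep[k [y [_ _ //]]].
rewrite quadrant_vectorsS mem_cat !big_cons eqSS; apply/orP/and3P => [[]|[sz hp hq]].
- move=> /allpairsPdep[k [z [kq]]]; rewrite IHd => /and3P[sz hp hq] [-> ->].
  by move: kq; rewrite mem_iota sz => /=; case: k hq => [|k] /= hq kq; split=> //; lia.
- move=> /allpairsPdep[k [z [kq]]]; rewrite IHd => /and3P[sz hp hq] [-> ->].
  by move: kq; rewrite mem_iota sz => /= kq; rewrite -leq_subRL.
have {}sz : size y == d by [].
case: t hp hq => [[|k]|k] hp hq; rewrite ?[pos_part _]/= ?[neg_part _]/= in hp hq.
- left; apply/allpairsPdep; exists 0%N, y; split=> //.
  by rewrite IHd sz subn0 hp hq.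
- right; apply/allpairsPdep; exists k, y.
  have lt_kp : (k < p)%N by apply: leq_trans hp; rewrite leq_addr.
  by split=> //; rewrite ?mem_iota // IHd sz hq leq_subRL ?hp.
- left; apply/allpairsPdep; exists k.+1, y.
  have lt_kq : (k < q)%N by apply: leq_trans hq; rewrite leq_addr.
  by split=> //; rewrite ?mem_iota // IHd sz hp leq_subRL ?hq.
Qed.

Lemma quadrant_vectors_uniq d p q : uniq (quadrant_vectors d p q).
Proof.
elim: d p q => [|d IHd] p q //; rewrite quadrant_vectorsS cat_uniq; apply/and3P; split.
- apply: allpairs_uniq_dep => [|k _|]; rewrite ?iota_uniq //.
  by move=> [k1 y1] [k2 y2] _ _ /= [/eqP]; rewrite eqr_opp => /eqP[->] ->.
- apply/hasPn => y /allpairsPdep[k [z [_ _ ->]]].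
  by apply/negP => /allpairsPdep[k' [z' [_ _ []]]]; lia.
apply: allpairs_uniq_dep => [|k _|]; rewrite ?iota_uniq //.
by move=> [k1 y1] [k2 y2] _ _ /= [-> ->].
Qed.

Lemma size_quadrant_vectors d p q :
  size (quadrant_vectors d p q) = quadrant_sum d p q.
Proof.
elim: d p q => [|d IHd] p q; first by rewrite quadrant_sum0.
rewrite quadrant_sumS quadrant_vectorsS size_cat !size_allpairs_dep !sumnE !big_map.
have iotaE n : iota 0 n = index_iota 0 n by rewrite /index_iota subn0.
(* The list runs over the entry, the sum over the budget it leaves, so the index is reversed. *)
rewrite !iotaE !big_mkord; congr addn; rewrite (reindex_inj rev_ord_inj) /=;
  by apply: eq_bigr => k _; rewrite IHd; congr quadrant_sum; have := ltn_ord k; lia.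
Qed.

Lemma card_eq_seq (T : choiceType) (l : seq T) :
  uniq l -> ([set` l] #= `I_(size l))%card.
Proof.
move=> ul; have -> : [set` l] = [set` [fset x in l]%fset].
  by apply/seteqP; split=> x /=; rewrite !inE.
apply/card_eq_fsetP; rewrite card_fseq.
by rewrite undup_id.
Qed.

(** * Inequality description of the polytope *)

Lemma convex_hull_sum (R : realType) (E : lmodType R) (A : set E)
    (I : finType) (P : pred I) (w : I -> R) (a : I -> E) :
  (forall i, P i -> 0 <= w i) -> \sum_(i | P i) w i = 1 ->
  (forall i, P i -> A (a i)) ->
  convex_hull A (\sum_(i | P i) w i *: a i).
Proof.
move=> w0 w1 aA; exists #|P|, (w \o enum_val), (a \o enum_val).
split=> [i||i|] /=.
- by apply: w0; have := enum_valP i.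
- by rewrite -[RHS]w1; apply/esym/(big_enum_val w).
- by apply: aA; have := enum_valP i.
- exact: (big_enum_val (fun i => w i *: a i)).
Qed.

Section polytope.
Variables (R : realType).

Lemma sum_indic (V : finType) (v : V) : \sum_t (t == v)%:R = 1 :> R.
Proof.
rewrite (bigD1 v) //= eqxx big1 ?addr0 // => t /negPf tv.
by rewrite tv.
Qed.

(** Edge vectors satisfy both conditions, and both are preserved by convex combinations. *)
Lemma convex_hull_edge_vectors_sub (V : finType) (G : sgraph V) x :
  convex_hull (edge_vectors R G) x ->
  \sum_v x v = 0 /\ \sum_v `|x v : R| <= 2.
Proof.
move=> [k [w [a [w0 w1 aA ->]]]].
have sum_a i : \sum_v a i v = 0.
  have [u [v [_ ->]]] := aA i.
  under eq_bigr do rewrite !ffunE.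
  by rewrite sumrB !sum_indic subrr.
have norm_a i : \sum_v `|a i v : R| <= 2.
  have [u [v [_ ->]]] := aA i.
  rewrite [2](_ : _ = \sum_(t : V) ((t == u)%:R + (t == v)%:R)); last first.
    by rewrite big_split /= !sum_indic.
  apply: ler_sum => t _; rewrite !ffunE (le_trans (ler_normB _ _)) //.
  by rewrite !normr_nat.
split.
  under eq_bigr do rewrite sum_ffunE.
  rewrite exchange_big big1 // => i _ /=.
  under eq_bigr do rewrite ffunE.
  by rewrite -scaler_sumr sum_a scaler0.
apply: (@le_trans _ _ (\sum_i w i * \sum_v `|a i v : R|)).
  under [leRHS]eq_bigr do rewrite mulr_sumr.
  rewrite exchange_big; apply: ler_sum => v _ /=.
  rewrite sum_ffunE (le_trans (ler_norm_sum _ _ _)) //.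
  by apply: ler_sum => i _; rewrite ffunE normrM ger0_norm.
rewrite [2](_ : _ = \sum_i w i * 2); last by rewrite -mulr_suml w1 mul1r.
by apply: ler_sum => i _; apply: ler_wpM2l.
Qed.

Lemma sum_mul_indic (V : finType) (f : V -> R) t : \sum_u f u * (t == u)%:R = f t.
Proof.
rewrite (bigD1 t) //= eqxx mulr1 big1 ?addr0 // => u /negPf ut.
by rewrite eq_sym ut mulr0.
Qed.

Lemma sum_swap (V : finType) (f : V -> V -> R) :
  \sum_(e : V * V | e.1 != e.2) f e.1 e.2 = \sum_(e : V * V | e.1 != e.2) f e.2 e.1.
Proof.
pose sw (e : V * V) := (e.2, e.1).
have swK : involutive sw by case.
rewrite (reindex_inj (inv_inj swK)) /=.
by apply: eq_bigl => -[u v] /=; rewrite eq_sym.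
Qed.

Lemma convex_hull_edge_vectors_complete n (p : {ffun 'I_n -> R^o}) (u0 v0 : 'I_n) :
  u0 != v0 -> \sum_v p v = 0 -> \sum_v `|p v : R| <= 2 ->
  convex_hull (edge_vectors R (complete_graph n)) p.
Proof.
move=> uv0 p0 p2.
(* Positive and negative parts of [p]. As the coordinates sum to 0, each part has total half the
   l1-norm, hence at most 1. *)
pose q v : R := (`|p v : R| + p v) / 2; pose r v : R := (`|p v : R| - p v) / 2.
have q0 v : 0 <= q v.
  by rewrite divr_ge0 // -lerBlDr sub0r -normrN ler_norm.
have r0 v : 0 <= r v by rewrite divr_ge0 // subr_ge0 ler_norm.
have qr v : q v * r v = 0.
  rewrite /q /r; move: (p v : R) => a.
  by rewrite mulrACA [X in X * _]mulrC -subr_sqr real_normK ?num_real // subrr mul0r.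
pose m := \sum_v q v.
have sr : \sum_v r v = m.
  by rewrite /m -!mulr_suml sumrB big_split /= p0 addr0 subr0.
have m1 : m <= 1.
  by rewrite /m -mulr_suml big_split /= p0 addr0 ler_pdivrMr // mul1r.
have m0 : 0 <= m by apply: sumr_ge0.
have m_eq0 v : m = 0 -> q v = 0 /\ r v = 0.
  move=> mz; have rz : \sum_v r v = 0 by rewrite sr.
  by split; [exact: (psumr_eq0P (fun i _ => q0 i) mz)
            | exact: (psumr_eq0P (fun i _ => r0 i) rz)].
pose N : R := #|[pred e : 'I_n * 'I_n | e.1 != e.2]|%:R.
have N0 : 0 < N by rewrite ltr0n; apply/card_gt0P; exists (u0, v0).
(* The weights q u * r v / m represent p but add up to m only; the remaining
   mass 1 - m is spread uniformly over all edge vectors, whose sum is 0.  If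
   m = 0 then p = 0, and x / 0 = 0 makes the first term vanish as it should. *)
pose w (e : 'I_n * 'I_n) : R := q e.1 * r e.2 / m + (1 - m) / N.
have -> : p = \sum_(e : 'I_n * 'I_n | e.1 != e.2)
                w e *: (basis_vec R e.1 - basis_vec R e.2).
  apply/ffunP => t; rewrite sum_ffunE.
  transitivity (\sum_(e : 'I_n * 'I_n | e.1 != e.2)
      (q e.1 * r e.2 / m * ((t == e.1)%:R - (t == e.2)%:R)
       + (1 - m) / N * ((t == e.1)%:R - (t == e.2)%:R)) : R); last first.
    by apply: eq_bigr => e _; rewrite !ffunE -mulrDl.
  rewrite big_split /= -mulr_sumr sumrB -(sum_swap (fun u v => (t == u)%:R)).
  rewrite subrr mulr0 addr0 big_mkcond /=.
  transitivity (\sum_u \sum_v (q u * r v / m * ((t == u)%:R - (t == v)%:R))).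
    have pE : p t = q t - r t by rewrite /q /r; move: (p t : R) => a; lra.
    have termE u v : q u * r v / m * ((t == u)%:R - (t == v)%:R)
        = q u * (t == u)%:R * (r v / m) - q u / m * (r v * (t == v)%:R).
      by ring.
    under eq_bigr => u _ do under eq_bigr => v _ do rewrite termE.
    under eq_bigr do rewrite sumrB.
    rewrite sumrB -!big_distrlr /= -(mulr_suml _ _ r) -(mulr_suml _ _ q) sr -/m.
    rewrite !sum_mul_indic pE.
    have [/m_eq0 mz|mz] := eqVneq m 0.
      by rewrite !(mz t).1 !(mz t).2 !(mul0r, mulr0).
    by rewrite divff // mulr1 mul1r.
  rewrite pair_big; apply: eq_bigr => -[u v] _ /=.
  by case: (eqVneq u v) => //= ->; rewrite subrr mulr0.
apply: convex_hull_sum => [e _||[u v] uv].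
- apply: addr_ge0; apply: divr_ge0 => //; first exact: mulr_ge0.
    by rewrite subr_ge0.
- rewrite big_split /= sumr_const -[_ *+ _]mulr_natr divfK ?gt_eqF //.
  transitivity (m * m / m + (1 - m)); last first.
    have [->|mz] := eqVneq m 0; first by rewrite !mul0r subr0 add0r.
    by rewrite mulfK // addrC subrK.
  (* Over all pairs the products q u * r v add up to m * m; the diagonal ones vanish because the two
     parts have disjoint supports. *)
  congr (_ + _); rewrite -[X in _ = _ * X / _]sr big_distrlr mulr_suml /= big_mkcond.
  under [RHS]eq_bigr do rewrite mulr_suml.
  rewrite pair_big; apply: eq_bigr => -[u v] _ /=.
  by case: (eqVneq u v) => //= ->; rewrite qr mul0r.
- by exists u, v.
Qed.

Lemma symmetric_edge_polytope_complete n :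
  symmetric_edge_polytope R (complete_graph n) =
  [set p | \sum_v p v = 0 /\ \sum_v `|p v : R| <= 2].
Proof.
rewrite /symmetric_edge_polytope; case: ifPn => [edge|noedge]; apply/seteqP; split=> p.
- exact: convex_hull_edge_vectors_sub.
- move: edge => /existsP[u /existsP[v uv]] [p0 p2].
  exact: (convex_hull_edge_vectors_complete uv).
- by move=> ->; split; rewrite big1 // => v _; rewrite ffunE ?normr0.
(* Without edges there is at most one vertex, so the zero sum alone forces p = 0. *)
move=> [p0 _]; apply/ffunP => v; rewrite ffunE -[RHS]p0 (bigD1 v) //=.
rewrite big1 ?addr0 // => u uv; case/existsP: noedge; exists u.
by apply/existsP; exists v.
Qed.

Lemma scale_ffunE (V : finType) (s : R) (p : {ffun V -> R^o}) v :
  (s *: p) v = s * p v :> R.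
Proof. by rewrite ffunE. Qed.

Lemma dilate_polytope_complete n (s : R) : 0 <= s ->
  dilate s (symmetric_edge_polytope R (complete_graph n)) =
  [set x | \sum_v x v = 0 /\ \sum_v `|x v : R| <= s * 2].
Proof.
move=> s0; rewrite symmetric_edge_polytope_complete; apply/seteqP; split=> x.
- move=> [p [p0 p2] <-]; split.
    by under eq_bigr do rewrite scale_ffunE; rewrite -mulr_sumr p0 mulr0.
  under eq_bigr do rewrite scale_ffunE normrM (ger0_norm s0).
  by rewrite -mulr_sumr ler_wpM2l.
(* For s = 0 the norm bound forces x = 0; otherwise the preimage is x / s. *)
move=> [x0 x2]; have [sz|sn0] := eqVneq s 0.
  exists 0; last first.
    rewrite scaler0; apply/ffunP => v; rewrite ffunE; apply/esym/eqP.
    rewrite -normr_eq0 eq_le normr_ge0 andbT.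
    move: x2; rewrite sz mul0r; apply: le_trans.
    by rewrite (bigD1 v) //= lerDl sumr_ge0.
  by split; rewrite big1 // => v _; rewrite ffunE ?normr0.
have sp : 0 < s by rewrite lt_neqAle eq_sym sn0.
exists (s^-1 *: x); last by rewrite scalerA divff // scale1r.
split; first by under eq_bigr do rewrite scale_ffunE; rewrite -mulr_sumr x0 mulr0.
under eq_bigr do rewrite scale_ffunE normrM ger0_norm ?invr_ge0 //.
by rewrite -mulr_sumr mulrC ler_pdivrMr // mulrC.
Qed.

End polytope.

(** * Lattice points of the dilated polytope *)

Lemma sum_int_parts (y : seq int) :
  \sum_(t <- y) t = (\sum_(t <- y) pos_part t)%:Z - (\sum_(t <- y) neg_part t)%:Z.
Proof.
elim: y => [|t y IHy]; first by rewrite !big_nil.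
by rewrite !big_cons IHy !PoszD; case: t => k /=; lia.
Qed.

Lemma sum_norm_parts (y : seq int) :
  \sum_(t <- y) `|t| = (\sum_(t <- y) pos_part t)%:Z + (\sum_(t <- y) neg_part t)%:Z.
Proof.
elim: y => [|t y IHy]; first by rewrite !big_nil.
by rewrite !big_cons IHy !PoszD; case: t => k /=; lia.
Qed.

(** If P and N are the positive and negative totals of y, then |P - N| + P + N = 2 max(P, N); so the
    l1 bound on y extended by minus its sum bounds P and N by s. *)
Lemma quadrant_vectorsE d s y :
  (y \in quadrant_vectors d s s) =
  (size y == d) && (`|- \sum_(t <- y) t| + \sum_(t <- y) `|t| <= s%:Z * 2).
Proof.
rewrite mem_quadrant_vectors sum_int_parts sum_norm_parts; congr andb.
by move: (\sum_(t <- y) pos_part t)%N (\sum_(t <- y) neg_part t)%N => p q; lia.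
Qed.

Section lattice_points.
Variable R : realType.

Definition int_vec n (l : seq int) : {ffun 'I_n -> R^o} :=
  [ffun i : 'I_n => (nth 0 l i)%:~R].

Lemma sum_int_vec n l (f : int -> int) (g : R -> R) :
  (forall t, g t%:~R = (f t)%:~R) -> size l = n ->
  \sum_i g (int_vec n l i) = (\sum_(t <- l) f t)%:~R.
Proof.
move=> gf sz; rewrite (big_nth 0) sz big_mkord rmorph_sum /=.
by apply: eq_bigr => i _; rewrite ffunE gf.
Qed.

Lemma int_vec_inj n l1 l2 :
  size l1 = n -> size l2 = n -> int_vec n l1 = int_vec n l2 -> l1 = l2.
Proof.
move=> s1 s2 e; apply: (@eq_from_nth _ 0) => [|i]; first by rewrite s1.
rewrite s1 => lt_in; have /ffunP/(_ (Ordinal lt_in)) := e.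
by rewrite !ffunE /= => /intr_inj.
Qed.

Definition lattice_points d s : seq {ffun 'I_d.+1 -> R^o} :=
  [seq int_vec d.+1 (- (\sum_(t <- y) t) :: y) | y <- quadrant_vectors d s s].

Lemma lattice_points_complete d (s : nat) :
  dilate s%:R (symmetric_edge_polytope R (complete_graph d.+1))
    `&` integer_lattice R 'I_d.+1 = [set` lattice_points d s].
Proof.
have s2E : s%:R * 2 = (s%:Z * 2)%:~R :> R by rewrite intrM.
rewrite dilate_polytope_complete ?ler0n //; apply/seteqP; split=> x /=.
- move=> [[x0 x2] xZ].
  pose l : seq int := [seq Num.floor (x i : R) | i : 'I_d.+1].
  have sl : size l = d.+1 by rewrite size_map size_enum_ord.
  have xE : x = int_vec d.+1 l.
    apply/ffunP => i; rewrite ffunE (nth_map i) ?size_enum_ord //.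
    by rewrite nth_ord_enum floorK.
  move: x0 x2; rewrite xE (@sum_int_vec _ _ id id) //.
  rewrite (@sum_int_vec _ _ (fun t => `|t|) (fun t => `|t|)) //; last first.
    by move=> t; rewrite intr_norm.
  (* The zero sum determines the head [t] from the tail [y]. *)
  case: l sl {xE} => // t y [sy] /eqP.
  rewrite intr_eq0 !big_cons addr_eq0 => /eqP tE.
  rewrite s2E ler_int => le2.
  apply/mapP; exists y; last by rewrite -tE.
  by rewrite quadrant_vectorsE sy eqxx -tE.
move=> /mapP[y]; rewrite quadrant_vectorsE => /andP[/eqP sy le2] ->.
split; last by move=> v; rewrite ffunE intr_int.
split.
  by rewrite (@sum_int_vec _ _ id id) //= ?sy // big_cons addNr.
rewrite (@sum_int_vec _ _ (fun t => `|t|) (fun t => `|t|)) /= ?sy //; last first.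
  by move=> t; rewrite intr_norm.
by rewrite s2E ler_int big_cons.
Qed.

Lemma card_lattice_points d s :
  ([set` lattice_points d s] #= `I_(crystal_ball d s))%card.
Proof.
rewrite -quadrant_sum_diag -size_quadrant_vectors.
rewrite -(size_map (fun y => int_vec d.+1 (- (\sum_(t <- y) t) :: y))).
apply: card_eq_seq; rewrite map_inj_in_uniq ?quadrant_vectors_uniq //.
move=> y1 y2; rewrite !quadrant_vectorsE => /andP[/eqP s1 _] /andP[/eqP s2 _].
have size_cons (t : int) y : size y = d -> size (t :: y) = d.+1 by move=> <-.
by move=> /(int_vec_inj (size_cons _ _ s1) (size_cons _ _ s2)) [].
Qed.

(** * The Ehrhart polynomial and its roots *)

(** Defined by the recurrence itself, so that it also holds at complex arguments. *)
Fixpoint crystal_poly (d : nat) : {poly R} :=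
  match d with
  | 0 => 1
  | d1.+1 =>
    match d1 with
    | 0 => 2%:R *: 'X + 1
    | d2.+1 => (d ^ 2)%:R^-1 *:
        ((d1.*2.+1)%:R *: ((2%:R *: 'X + 1) * crystal_poly d1)
         + (d1 ^ 2)%:R *: crystal_poly d2)
    end
  end.
End lattice_points.

Lemma crystal_polySS (R : realType) d : crystal_poly R d.+2 =
  (d.+2 ^ 2)%:R^-1 *: ((d.*2.+3)%:R *: ((2%:R *: 'X + 1) * crystal_poly R d.+1)
                       + (d.+1 ^ 2)%:R *: crystal_poly R d).
Proof. by []. Qed.

Lemma horner_crystal_poly (R : realType) d s :
  (crystal_poly R d).[s%:R] = (crystal_ball d s)%:R.
Proof.
have oddE : (s.*2.+1)%:R = 2%:R * s%:R + 1 :> R by rewrite -natr1 -mul2n natrM.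
suff [] : (crystal_poly R d).[s%:R] = (crystal_ball d s)%:R
  /\ (crystal_poly R d.+1).[s%:R] = (crystal_ball d.+1 s)%:R by [].
elim: d => [|d [IH1 IH2]].
  rewrite crystal_ball0 crystal_ball1 oddE /=.
  by split; rewrite !hornerE.
split=> //; rewrite crystal_polySS !hornerE IH1 IH2.
have n0 : (d.+2 ^ 2)%:R != 0 :> R by rewrite pnatr_eq0.
apply: (mulfI n0); rewrite mulVKf // -[RHS]natrM crystal_ball_rec natrD !natrM.
by rewrite -oddE.
Qed.

(** Multiply the recurrence by conj (h d.+1), take real parts and multiply by Re u: the u-term
    becomes a nonnegative multiple of (Re u)^2 |h d.+1|^2, and the last term is positive by
    induction, since Re (h d * conj (h d.+1)) is symmetric in the two factors. *)
Lemma recurrence_neq0 (R : realType) (u : R[i]) (h : nat -> R[i]) :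
  h 0%N = 1 -> h 1%N = u ->
  (forall d, (d.+2 ^ 2)%:R * h d.+2
     = (d.*2.+3)%:R * (u * h d.+1) + (d.+1 ^ 2)%:R * h d) ->
  complex.Re u != 0 -> forall d, h d != 0.
Proof.
move=> h0 h1 hrec u0 d.
suff : 0 < complex.Re u * complex.Re (h d.+1 * conjc (h d)).
  by apply: contraTneq => ->; rewrite conjc0 mulr0 /= mulr0 ltxx.
elim: d => [|d IHd].
  by rewrite h0 h1 conjc1 mulr1 -expr2 exprn_even_gt0.
have {hrec} := hrec d; clear h0 h1.
move: (h d) (h d.+1) (h d.+2) u u0 IHd => [a b] [a' b'] [x y] [p q] /= p0 IHd.
(* Writing the numerals as embedded reals splits the equation into real and imaginary parts. *)
rewrite -!(rmorph_nat (real_complex R)) /=.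
set N := (d.+2 ^ 2)%:R; set M := d.*2.+3%:R; set K := (d.+1 ^ 2)%:R => -[].
rewrite !(mul0r, subr0, addr0) => ex ey.
have N0 : 0 < N by rewrite ltr0n.
have M0 : 0 <= M by rewrite ler0n.
have K0 : 0 < K by rewrite ltr0n.
rewrite -(pmulr_rgt0 _ N0).
rewrite [X in 0 < X](_ : _ = M * p ^+ 2 * (a' ^+ 2 + b' ^+ 2)
    + K * (p * (a' * a - b' * - b))).
  apply: ltr_wpDl; last exact: mulr_gt0.
  apply: mulr_ge0; last by apply: addr_ge0; apply: sqr_ge0.
  by apply: mulr_ge0 => //; apply: sqr_ge0.
transitivity (p * (N * x * a' + N * y * b')); first by ring.
by rewrite ex ey; ring.
Qed.


Theorem corollary3p8 (R : realType) (n : nat) (z : R[i]) :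
  root (map_poly (real_complex R)
          (ehrhart_poly (symmetric_edge_polytope R (complete_graph n)))) z ->
  complex.Re z = - (1 / 2%:R).
Proof.
have -> : ehrhart_poly (symmetric_edge_polytope R (complete_graph n))
    = crystal_poly R n.-1.
  have eh : is_ehrhart (symmetric_edge_polytope R (complete_graph n))
                       (crystal_poly R n.-1).
    move=> s; exists (crystal_ball n.-1 s).
    split; last exact: horner_crystal_poly.
    case: n => [|d]; last by rewrite lattice_points_complete card_lattice_points.
    (* For n = 0 the ambient space is the single point 0, and [n.-1] is 0 with count 1. *)
    rewrite crystal_ball0 (_ : _ `&` _ = [set 0]) ?card_set1 //.
    apply/seteqP; split=> x /=; first by move=> _; apply/ffunP => -[].
    move=> ->; split; last by move=> [].
    rewrite dilate_polytope_complete ?ler0n //=.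
    by rewrite !big_ord0 mulr_ge0 ?ler0n.
  (* By [eh] such a polynomial exists, so [xget] does not fall back on its default 0. *)
  rewrite /ehrhart_poly; apply: (is_ehrhart_uniq _ eh).
  exact: (@xgetPex _ 0 [set H | is_ehrhart _ H] (ex_intro _ _ eh)).
move=> /rootP rz; apply/eqP; apply: contraTT isT => zN.
pose h d := (map_poly (real_complex R) (crystal_poly R d)).[z].
suff : h n.-1 != 0 by rewrite /h rz eqxx.
have u_horner : (map_poly (real_complex R) (2%:R *: 'X + 1)).[z] = 2%:R * z + 1.
  rewrite rmorphD /= (map_polyZ (real_complex R)) map_polyX rmorph1.
  by rewrite !hornerE rmorph_nat.
apply: (@recurrence_neq0 _ (2%:R * z + 1) h) => [||d|].
- by rewrite /h rmorph1 hornerE.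
- exact: u_horner.
- rewrite /h crystal_polySS.
  move: (crystal_poly R d.+1) (crystal_poly R d) => p q.
  rewrite (map_polyZ (real_complex R)) rmorphD /= !(map_polyZ (real_complex R)).
  rewrite fmorphV !rmorph_nat rmorphM hornerZ hornerD !hornerZ hornerM u_horner.
  by rewrite mulVKf // pnatr_eq0.
apply: contraNneq zN; case: z {rz h u_horner} => a b /= uz.
by apply/eqP; move: uz; lra.
Qed.
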